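(* Let $n,k,s$ be non-negative integers and let $\alpha\in(1,2-1/k]$ be a real number such that $n\ge \alpha k(s+1)+k-1$. If $\mathcal{F}\subseteq\binom{[n]}{k}$ satisfies $\nu(\mathcal{F})=s$, then \[ |\mathcal{F}|\le \binom nk - \binom{n-s}k + \frac{(2-\alpha)k-1}{\alpha k-1}\, s\binom{n-s-1}{k-1}. \]
   Context: $\binom{[n]}{k}$ is the family of all $k$-element subsets of $[n]=\{1,\dots,n\}$. For a family $\mathcal{F}$ of sets, $\nu(\mathcal{F})$ denotes the maximum number of pairwise disjoint members of $\mathcal{F}$ (the size of a maximum matching). *)

(* Defs.v *)
From HB Require Import structures.
From mathcomp Require Import all_boot all_order all_algebra.
From mathcomp Require Import reals.
Set Implicit Arguments. Unset Strict Implicit. Unset Printing Implicit Defensive.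

Definition is_matching (n : nat) (F M : {set {set 'I_n}}) : bool :=
  (M \subset F) &&
  [forall A in M, forall B in M, (A != B) ==> [disjoint A & B]].

Definition nu (n : nat) (F : {set {set 'I_n}}) : nat :=
  \max_(M : {set {set 'I_n}} | is_matching F M) #|M|.

(* Main.v *)
(* Shift F, and let Y be the ground set without its first s+1 elements. Sets
   with at least two elements outside Y are bounded trivially. The family F(0)
   of members inside Y has no s+1 disjoint members, so |F(0)| <= s |shadow F(0)|
   (Frankl), and by shiftedness this shadow lies in the link F(s+1) restricted
   to Y. The restricted links F(1) >= ... >= F(s+1) contain no s+1 disjoint
   representatives, and it remains to bound
     |F(1)| + ... + |F(s)| + (s+1) |F(s+1)|.
   Throw t = (n-s-1) %/ (k-1) disjoint (k-1)-sets randomly into Y: for nested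
   families without distinct representatives some F(s+1-j) contains at most j of
   the t sets, so the weighted number of incidences is at most
   (s-j) t + j (2s+1), and t > (alpha k - 1)(s+1)/(k-1) makes this at most
   g s t with g = 2(k-1)/(alpha k - 1) = 1 + ((2-alpha)k-1)/(alpha k-1). *)
Require Import Defs.
From HB Require Import structures.
From mathcomp Require Import all_boot all_order all_algebra all_fingroup.
From mathcomp Require Import reals.
From mathcomp Require Import zify ring lra.
Import Order.TTheory GRing.Theory Num.Theory.
Set Implicit Arguments. Unset Strict Implicit. Unset Printing Implicit Defensive.

(** * Indexed matchings, links and shadows *)

(* Distinct indices may carry the same set only if it is empty; so a family
   containing the empty set has matchings of every length. *)
Definition rainbow (T : finType) (m : nat) (H : nat -> {set {set T}}) : Prop :=
  exists2 f : nat -> {set T}, forall i, i < m -> f i \in H i &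
    forall i j, i < m -> j < m -> i != j -> [disjoint f i & f j].

Definition link (T : finType) (G : {set {set T}}) (x : T) : {set {set T}} :=
  [set B : {set T} | (x \notin B) && (x |: B \in G)].

Definition shadow (T : finType) (G : {set {set T}}) : {set {set T}} :=
  [set B : {set T} | [exists x, B \in link G x]].

(** Relative to a ground set [W], because the induction for the shadow inequality deletes points;
    elements move towards smaller ones. *)
Definition shifted_on n (W : {set 'I_n}) (G : {set {set 'I_n}}) : Prop :=
  forall (B : {set 'I_n}) (x y : 'I_n), x \in W -> y \in W -> x < y ->
    x \notin B -> y \notin B -> y |: B \in G -> x |: B \in G.

(** Without the empty set, pairwise disjoint [f i] are distinct, so an indexed matching of length
    [m] has [m] members. *)
Lemma nu_rainbow n (F : {set {set 'I_n}}) m :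
  set0 \notin F -> rainbow m (fun=> F) -> m <= nu F.
Proof.
move=> F0 [f fF fD].
have finj : {in [pred i : 'I_m | true] &, injective (fun i : 'I_m => f i)}.
  move=> i j _ _ fij; apply/eqP; case: (eqVneq i j) => // nij.
  have := fD i j (ltn_ord i) (ltn_ord j) nij.
  rewrite -fij -setI_eq0 setIid => fi0.
  by move: F0; rewrite -(eqP fi0) fF.
pose M := [set f (i : 'I_m) | i in [pred i : 'I_m | true]].
have cM : #|M| = m by rewrite card_in_imset // card_ord.
rewrite -{1}cM; suff MF : is_matching F M by exact: (@leq_bigmax_cond _ (is_matching F) (fun M0 : {set {set 'I_n}} => #|M0|) M MF).
apply/andP; split.
  by apply/subsetP => A /imsetP[i _ ->]; apply: fF.
apply/forall_inP => A /imsetP[i _ ->]; apply/forall_inP => B /imsetP[j _ ->].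
apply/implyP => nij; apply: fD => //.
by apply: contraNneq nij => ij; rewrite (_ : i = j) //; apply: val_inj.
Qed.

Section Families.
Variable T : finType.
Implicit Types (G : {set {set T}}) (A B W : {set T}) (x y : T).

Lemma card_link G x : #|G| = #|[set A in G | x \notin A]| + #|link G x|.
Proof.
rewrite -(cardsID [set A : {set T} | x \notin A] G); congr (_ + _).
  by apply: eq_card => A; rewrite !inE.
rewrite -(card_in_imset (f := fun B => x |: B) (D := link G x)); last first.
  move=> B C; rewrite !inE => /andP[xB _] /andP[xC _] /(congr1 (fun A => A :\ x)).
  by rewrite !setU1K.
apply: eq_card => A; rewrite !inE negbK; apply/andP/imsetP.
  move=> [xA AG]; exists (A :\ x); last by rewrite setD1K.
  by rewrite !inE eqxx setD1K.
by move=> [B]; rewrite inE => /andP[_ BG] ->; rewrite setU11.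
Qed.

(** Count pairs of a set and a point: each member can lose any of its [k] points, and each shadow
    set can regain one in at most [#|W| - k.-1] ways. *)
Lemma shadow_double_count G k W :
  {in G, forall A, (#|A| == k) && (A \subset W)} ->
  #|G| * k <= #|shadow G| * (#|W| - k.-1).
Proof.
move=> Gk.
pose P := [set p : {set T} * T | (p.1 \in G) && (p.2 \in p.1)].
pose Q := [set p : {set T} * T | p.1 \in shadow G & p.2 \in W :\: p.1].
have cP : #|P| = #|G| * k.
  rewrite -sum1_card (eq_bigl (fun p : {set T} * T => (p.1 \in G) && (p.2 \in p.1))); last first.
    by move=> p; rewrite inE.
  rewrite -(pair_big_dep (mem G) (fun A x => x \in A) (fun _ _ => 1)) /=.
  rewrite -sum_nat_const; apply: eq_bigr => A AG.
  by rewrite sum1_card; apply/eqP; case/andP: (Gk _ AG).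
have cQ : #|Q| <= #|shadow G| * (#|W| - k.-1).
  rewrite -sum1_card (eq_bigl (fun p : {set T} * T => (p.1 \in shadow G) && (p.2 \in W :\: p.1))); last first.
    by move=> p; rewrite inE.
  rewrite -(pair_big_dep (mem (shadow G)) (fun A x => x \in W :\: A) (fun _ _ => 1)) /=.
  rewrite -sum_nat_const; apply: leq_sum => B.
  rewrite inE => /existsP[x]; rewrite inE => /andP[xB xG].
  have /andP[/eqP xk xW] := Gk _ xG.
  rewrite sum1_card cardsD (setIidPr _); last by apply: subset_trans xW; apply: subsetU1.
  by rewrite -xk cardsU1 xB.
rewrite -cP; apply: leq_trans cQ.
pose h (p : {set T} * T) := (p.1 :\ p.2, p.2).
rewrite -(card_in_imset (f := h) (D := P)); last first.
  move=> [A x] [B y]; rewrite !inE /= => /andP[_ xA] /andP[_ yB] [AB xy].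
  by subst y; rewrite -(setD1K xA) AB setD1K.
apply: subset_leq_card; apply/subsetP => z /imsetP[[A x] ]; rewrite inE /= => /andP[AG xA] ->.
have /andP[_ AW] := Gk _ AG.
rewrite !inE /= eqxx /= (subsetP AW) // andbT.
by apply/existsP; exists x; rewrite !inE eqxx setD1K.
Qed.

Lemma shadow_link_sub G x : shadow (link G x) \subset link (shadow G) x.
Proof.
apply/subsetP => B; rewrite !inE => /existsP[y]; rewrite !inE => /and3P[yB].
rewrite negb_or => /andP[xy xB] xyG; rewrite xB; apply/existsP; exists y.
by rewrite !inE negb_or yB eq_sym xy setUCA.
Qed.

End Families.

(** * Frankl's shadow inequality *)

Section Shadow.
Variable n : nat.
Implicit Types (G : {set {set 'I_n}}) (W : {set 'I_n}).

Lemma exists_max W : W != set0 -> exists2 w, w \in W & {in W, forall x : 'I_n, x <= w}.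
Proof.
case/set0Pn => x0 xW; case: (@arg_maxnP _ x0 (mem W) (fun x => x : nat) xW) => w wW wm.
by exists w.
Qed.

Lemma card_bigcup_ord (T : finType) m c (f : nat -> {set T}) :
  (forall i, i < m -> #|f i| <= c) -> #|\bigcup_(i < m) f i| <= m * c.
Proof.
elim: m => [|m IH] fc; first by rewrite big_ord0 cards0.
rewrite big_ord_recr mulSn addnC; apply: leq_trans (leq_card_setU _ _).1 _.
by apply: leq_add; [apply: IH => i /ltnW/fc | apply: fc].
Qed.

(* The removed maximum [w] is replaced, by shifting, with a different element
   of [W] for each member of the matching; [k * s.+1 <= #|W|] leaves room. *)
Lemma rainbow_link_max G W w k s :
  0 < k -> k * s.+1 <= #|W| -> w \in W -> {in W, forall x : 'I_n, x <= w} -> shifted_on W G ->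
  {in G, forall A : {set 'I_n}, (#|A| == k) && (A \subset W)} ->
  rainbow s.+1 (fun=> link G w) -> rainbow s.+1 (fun=> G).
Proof.
move=> k0 kW wW wm sh Gk [f fG fD].
pose U := \bigcup_(i < s.+1) f i.
have cU : #|U| <= s.+1 * k.-1.
  apply: card_bigcup_ord => i lt; have := fG i lt.
  by rewrite inE => /andP[wf /Gk/andP[/eqP <- _]]; rewrite cardsU1 wf.
have cD : s < #|W :\: U|.
  rewrite cardsD; have := subset_leq_card (subsetIr W U); nia.
pose x i := nth w (enum (W :\: U)) i.
have xD i : i < s.+1 -> x i \in W :\: U.
  by move=> lt; rewrite -mem_enum mem_nth // -cardE (leq_trans lt).
have fU i : i < s.+1 -> f i \subset U by move=> lt; apply: (bigcup_sup (Ordinal lt)).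
have xf i j : i < s.+1 -> j < s.+1 -> x i \notin f j.
  move=> lti ltj; have := xD i lti; rewrite inE => /andP[+ _].
  by apply: contra; apply: subsetP; apply: fU.
exists (fun i => x i |: f i) => [i lt|i j lti ltj ij].
  have := fG i lt; rewrite inE => /andP[wf wfG].
  have := xD i lt; rewrite inE => /andP[_ xW].
  (* The point [w] avoids every [f i], so it may be among the chosen replacements; then nothing
     needs shifting. *)
  have [->//|xw] := eqVneq (x i) w.
  by apply: sh wfG => //; [rewrite ltn_neqAle xw wm | apply: xf].
have fij := fD i j lti ltj ij.
rewrite disjoint_subset; apply/subsetP => z; rewrite !inE => /orP[/eqP ->|zi].
  rewrite negb_or xf // andbT.
  by rewrite nth_uniq ?enum_uniq // -cardE (leq_trans _ cD).
rewrite negb_or (disjointFr fij zi) andbT.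
by apply: contraNneq (xf j i ltj lti) => <-.
Qed.

(* Frankl's shadow inequality, by induction on [W]: double counting when [W] is
   small, otherwise splitting the family along the maximum of [W]. *)
Lemma shadow_bound W G k s :
  shifted_on W G -> {in G, forall A : {set 'I_n}, (#|A| == k) && (A \subset W)} ->
  ~ rainbow s.+1 (fun=> G) -> #|G| <= s * #|shadow G|.
Proof.
move: {2}#|W| (leqnn #|W|) => N; elim: N W G k => [|N IH] W G k WN sh Gk Gs.
all: case: k Gk => [|k] Gk.
(* For [k = 0] the only possible member is the empty set, which alone yields rainbow matchings of
   every length. *)
1,3: suff -> : G = set0 by rewrite cards0.
1,2: apply/setP => A; rewrite inE; apply/negP => AG; apply: Gs.
1,2: have A0 : A = set0 by apply/eqP; rewrite -cards_eq0; case/andP: (Gk _ AG).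
1,2: by exists (fun=> A) => // i j _ _ _; rewrite A0 disjoints_subset sub0set.
all: case: (leqP (k.+1 * s.+1) #|W|) => kW.
2,4: have := shadow_double_count Gk => /= dc.
(* Small ground set: [#|W| < k.+1 * s.+1] makes the double-counting factor at most [k.+1 * s]. *)
2,3: have le : #|W| - k <= k.+1 * s by rewrite leq_subLR; nia.
2,3: rewrite -(leq_pmul2r (ltn0Sn k)); apply: (leq_trans dc).
2,3: by rewrite (mulnC s) -mulnA leq_mul2l mulnC le orbT.
  by move: (leq_trans kW WN); rewrite mulnS.
have W0 : W != set0 by rewrite -card_gt0; apply: leq_trans kW; rewrite muln_gt0.
have [w wW wm] := exists_max W0.
have WD x : x \in W :\ w -> x \in W by rewrite inE => /andP[].
have cW : #|W :\ w| <= N by move: WN; rewrite (cardsD1 w) wW.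
have b0 : #|[set A in G | w \notin A]| <= s * #|shadow [set A in G | w \notin A]|.
  apply: (IH (W :\ w) _ k.+1) => //.
  - move=> B x y /[dup] xw /WD xW /WD yW xy xB yB.
    move: xw; rewrite !inE !negb_or => /andP[xw _].
    by move=> /and3P[/(sh B x y xW yW xy xB yB) -> _ ->]; rewrite eq_sym xw.
  - move=> A; rewrite inE => /andP[/Gk/andP[-> AW] wA] /=.
    by rewrite subsetD1 AW.
  - case=> f fG fD; apply: Gs; exists f => // i /fG; by rewrite inE => /andP[].
have b1 : #|link G w| <= s * #|shadow (link G w)|.
  apply: (IH (W :\ w) _ k) => //.
  - move=> B x y /[dup] xw /WD xW /[dup] yw /WD yW xy xB yB.
    move: xw yw; rewrite !inE !negb_or => /andP[xw _] /andP[yw _].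
    move=> /andP[/andP[yw' wB] wyB]; rewrite eq_sym xw wB /= setUCA.
    by apply: (sh _ x y) => //; rewrite 1?setUCA // !inE negb_or ?xw ?yw.
  - move=> A; rewrite inE => /andP[wA /Gk /andP[+ +]].
    rewrite cardsU1 wA eqSS subUset => -> /= /andP[_ AW].
    by rewrite subsetD1 AW.
  - by move/(rainbow_link_max (ltn0Sn k) kW wW wm sh Gk).
(* The shadow splits in the same way: its sets avoiding [w] contain the shadow of the members
   avoiding [w], and its link at [w] contains the shadow of [link G w]. *)
rewrite (card_link G w) (card_link (shadow G) w) mulnDr leq_add //.
  apply: (leq_trans b0); rewrite leq_mul2l; apply/orP; right.
  apply: subset_leq_card; apply/subsetP => B; rewrite !inE => /existsP[x].
  rewrite !inE negb_or => /andP[xB /and3P[xG _ ->]]; rewrite andbT.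
  by apply/existsP; exists x; rewrite inE xB.
apply: (leq_trans b1); rewrite leq_mul2l; apply/orP; right.
exact/subset_leq_card/shadow_link_sub.
Qed.

End Shadow.

(** * Shifting *)

Section Shifting.
Variables (n : nat) (x y : 'I_n).
Implicit Types (F : {set {set 'I_n}}) (A B C : {set 'I_n}).

(** A transposition preserves size and disjointness of arbitrary sets; on a set with [y] but not [x]
    it is the usual replacement of [y] by [x]. *)
Definition swap A := tperm x y @: A.

Lemma swapK : involutive swap.
Proof.
move=> A; rewrite /swap -imset_comp -[RHS]imset_id.
by apply: eq_imset => z /=; rewrite tpermK.
Qed.

Lemma card_swap A : #|swap A| = #|A|.
Proof. exact/card_imset/perm_inj. Qed.

Lemma mem_swap A z : (z \in swap A) = (tperm x y z \in A).
Proof. by rewrite -{1}(tpermK x y z) mem_imset //; apply: perm_inj. Qed.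

Lemma swap_id A : x \notin A -> y \notin A -> swap A = A.
Proof.
move=> xA yA; apply/setP => z; rewrite mem_swap.
by case: tpermP => // ->; rewrite (negbTE xA) (negbTE yA).
Qed.

Lemma swapU1 B : x \notin B -> y \notin B -> swap (y |: B) = x |: B.
Proof. by move=> xB yB; rewrite /swap imsetU1 tpermR -/(swap B) swap_id. Qed.

Definition shift_set F A :=
  if [&& y \in A, x \notin A & swap A \notin F] then swap A else A.

Definition shift_family F := shift_set F @: F.

(** Moved sets land outside [F] and the others stay inside, so only sets of the same kind could
    collide, and [swap] is injective. *)
Lemma shift_set_inj F : {in F &, injective (shift_set F)}.
Proof.
move=> A B AF BF; rewrite /shift_set; case: ifP => [/and3P[_ _ sA]|_]; case: ifP => [/and3P[_ _ sB]|_] //.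
- exact: (can_inj swapK).
- by move=> e; move: sA; rewrite e BF.
- by move=> e; move: sB; rewrite -e AF.
Qed.

Lemma shift_familyP F C : C \in shift_family F ->
  C \in F /\ (y \in C -> x \notin C -> swap C \in F)
  \/ [/\ swap C \in F, x \in C & y \notin C].
Proof.
case/imsetP=> A AF ->; rewrite /shift_set; case: ifP => [/and3P[yA xA _]|h]; last first.
  by left; split=> // yA xA; move: h; rewrite yA xA /= => /negbFE.
by right; rewrite swapK !mem_swap tpermL tpermR.
Qed.

(* A matching of the shifted family that uses a new set becomes a matching of
   [F] once [x] and [y] are swapped in all its members. *)
Lemma rainbow_shift F m : rainbow m (fun=> shift_family F) -> rainbow m (fun=> F).
Proof.
case=> f fS fD.
case: (boolP [forall i : 'I_m, f i \in F]) => [/forallP fF|].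
  by exists f => // i lt; apply: (fF (Ordinal lt)).
rewrite negb_forall => /existsP[p pF].
have [[pF' _]|[_ xp yp]] := shift_familyP (fS p (ltn_ord p)); first by rewrite pF' in pF.
exists (fun i => swap (f i)) => [i lt|i j lti ltj ij]; last first.
  by rewrite imset_disjoint ?fD //; apply: perm_inj.
have [[iF iS]|[]//] := shift_familyP (fS i lt).
(* The new member [f p] contains [x], so an old one avoids it. If the old one contains [y], it
   stayed in place because its swap is in [F]; otherwise [swap] fixes it. *)
have xi : x \notin f i.
  have [e|ne] := eqVneq i p; first by rewrite -e iF in pF.
  by rewrite (disjointFl (fD i p lt (ltn_ord p) ne)).
by case: (boolP (y \in f i)) => [/iS->|/swap_id->].
Qed.

Definition set_weight A := \sum_(z in A) (z : nat).

Lemma swap_weight A : x < y -> y \in A -> x \notin A -> set_weight (swap A) < set_weight A.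
Proof.
move=> xy yA xA; rewrite /set_weight /swap big_imset /=; last by apply: in2W; apply: perm_inj.
rewrite (bigD1 y) // [X in _ < X](bigD1 y) //= tpermR -addSn leq_add //.
apply: leq_sum => z /andP[zA zy]; rewrite tpermD // 1?eq_sym //.
by apply: contraNneq xA => <-.
Qed.

Lemma shift_weight F B : x < y -> x \notin B -> y \notin B ->
  y |: B \in F -> x |: B \notin F ->
  \sum_(A in shift_family F) set_weight A < \sum_(A in F) set_weight A.
Proof.
move=> xy xB yB yF xF; have nyx : x != y by rewrite neq_ltn xy.
rewrite big_imset /=; last exact: shift_set_inj.
rewrite (bigD1 (y |: B)) // [X in _ < X](bigD1 (y |: B)) //= -addSn leq_add //.
  rewrite /shift_set swapU1 // xF !inE eqxx negb_or nyx xB /= -swapU1 //.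
  by apply: swap_weight => //; rewrite !inE ?eqxx // negb_or nyx.
apply: leq_sum => A /andP[AF _]; rewrite /shift_set; case: ifP => // /and3P[yA xA _].
exact/ltnW/swap_weight.
Qed.

End Shifting.

(** Each effective shift to a smaller element lowers the total [set_weight], so shifting
    terminates. *)
Lemma exists_shifted n (F : {set {set 'I_n}}) k m :
  {in F, forall A : {set 'I_n}, #|A| = k} -> ~ rainbow m (fun=> F) ->
  exists F' : {set {set 'I_n}}, [/\ #|F'| = #|F|, {in F', forall A : {set 'I_n}, #|A| = k},
    ~ rainbow m (fun=> F') & shifted_on setT F'].
Proof.
have [w] := ubnP (\sum_(A in F) set_weight A); elim: w F => // w IH F Fw Fk Fm.
case: (boolP [forall B : {set 'I_n}, forall x : 'I_n, forall y : 'I_n,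
   [&& x < y, x \notin B, y \notin B & y |: B \in F] ==> (x |: B \in F)]).
  move=> sh; exists F; split=> // B x y _ _ xy xB yB yF.
  move/forallP/(_ B)/forallP/(_ x)/forallP/(_ y)/implyP: sh; apply.
  by rewrite xy xB yB.
rewrite negb_forall => /existsP[B]; rewrite negb_forall => /existsP[x].
rewrite negb_forall => /existsP[y]; rewrite negb_imply => /andP[/and4P[xy xB yB yF] xF].
have [|||F' [c1 c2 c3 c4]] := IH (shift_family x y F).
- by exact: leq_trans (shift_weight xy xB yB yF xF) Fw.
- move=> A /shift_familyP[[/Fk//]|[+ _ _]].
  by move/Fk; rewrite card_swap.
- by move/rainbow_shift.
by exists F'; rewrite c1 card_in_imset //; apply: shift_set_inj.
Qed.

(** * Averaging over the permutations of [Y] *)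

Section Averaging.
Variables (T : finType) (Y : {set T}).
Implicit Types (A B C : {set T}) (H : {set {set T}}) (p q : {perm T}).

Definition perms_on : {set {perm T}} := [set p | perm_on Y p].

(** Transposing a point of [A :\: B] with one of [B :\: A] stays within [Y] and brings [A] closer to
    [B]. *)
Lemma perm_on_transitive A B : A \subset Y -> B \subset Y -> #|A| = #|B| ->
  exists2 p : {perm T}, perm_on Y p & p @: A = B.
Proof.
move: {2}#|A :\: B| (leqnn #|A :\: B|) => d; elim: d A => [|d IH] A dA AY BY cAB.
  exists 1%g; first exact: perm_on1.
  rewrite (eq_imset _ (@perm1 T)) imset_id; apply/eqP; rewrite eqEcard cAB leqnn andbT.
  by rewrite -setD_eq0 -cards_eq0 -leqn0.
have [AB0|/set0Pn[a]] := eqVneq (A :\: B) set0.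
  by apply: IH => //; rewrite AB0 cards0.
rewrite inE => /andP[aB aA].
have /set0Pn[b] : B :\: A != set0.
  rewrite -card_gt0 cardsD setIC -cAB -cardsD card_gt0; apply/set0Pn; exists a.
  by rewrite inE aB.
rewrite inE => /andP[bA bB].
have nab : a != b by apply: contraNneq aB => ->.
have tY : perm_on Y (tperm a b).
  apply: subset_trans (tperm_on a b) _; apply/subsetP => z.
  by rewrite !inE => /orP[]/eqP->; [apply: (subsetP AY) | apply: (subsetP BY)].
have memA z : (z \in tperm a b @: A) = (tperm a b z \in A).
  by rewrite -{1}(tpermK a b z) mem_imset //; apply: perm_inj.
have [||||p pY pA] := IH (tperm a b @: A).
- rewrite -ltnS; apply: leq_trans dA; apply: proper_card; apply/properP; split.
    apply/subsetP => z; rewrite !inE memA; case: tpermP => [->|->|] //.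
      by rewrite (negbTE bA) andbF.
    by rewrite bB.
  by exists a; rewrite !inE ?aB // memA tpermL (negbTE bA) andbF.
- by rewrite -(im_perm_on tY); apply: imsetS.
- exact: BY.
- by rewrite card_imset //; apply: perm_inj.
exists (tperm a b * p)%g; first exact: perm_onM.
by rewrite -pA -imset_comp; apply: eq_imset => z /=; rewrite permM.
Qed.

(** Right multiplication by a permutation of [Y] carrying [A] to [B] is a bijection. *)
Lemma card_perms_to A B C : A \subset Y -> B \subset Y -> #|A| = #|B| ->
  #|[set p in perms_on | p @: C == A]| = #|[set p in perms_on | p @: C == B]|.
Proof.
move=> AY BY cAB; have [q qY qA] := perm_on_transitive AY BY cAB.
have imM p : (p * q)%g @: C = q @: (p @: C).
  by rewrite -imset_comp; apply: eq_imset => z /=; rewrite permM.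
rewrite -[LHS](card_imset _ (mulIg q)); apply: eq_card => p; apply/imsetP/idP.
  move=> [r]; rewrite !inE => /andP[rY /eqP rC] ->.
  by rewrite perm_onM //= imM rC qA eqxx.
rewrite !inE => /andP[pY /eqP pC]; exists (p * q^-1)%g; last by rewrite mulgKV.
rewrite !inE perm_onM ?perm_onV //=; apply/eqP.
apply: (imset_inj (@perm_inj _ q)); rewrite qA -pC -imset_comp.
by apply: eq_imset => z /=; rewrite permM permKV.
Qed.

(** Under a random permutation of [Y] all [l]-subsets are equally likely images of [B]; the
    probability of landing in [H] is written with denominators cleared. *)
Lemma card_perms_into l B H :
  B \subset Y -> #|B| = l -> {in H, forall A : {set T}, (A \subset Y) && (#|A| == l)} ->
  'C(#|Y|, l) * #|[set p in perms_on | p @: B \in H]| = #|H| * #|perms_on|.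
Proof.
move=> BY Bl.
have split H' : {in H', forall A : {set T}, (A \subset Y) && (#|A| == l)} ->
    #|[set p in perms_on | p @: B \in H']| = #|H'| * #|[set p in perms_on | p @: B == B]|.
  move=> H'l; rewrite -sum1_card.
  rewrite (partition_big (fun p : {perm T} => p @: B) (mem H')) /=; last first.
    by move=> p; rewrite inE => /andP[].
  rewrite -sum_nat_const; apply: eq_bigr => A AH; have /andP[AY /eqP Al] := H'l _ AH.
  rewrite -(card_perms_to (A := A)) // ?Al // sum1dep_card; apply: eq_card => p.
  by rewrite !inE; case: eqP => [->|]; rewrite ?AH ?andbT ?andbF.
move=> Hl; rewrite split // mulnCA; congr (_ * _).
(* Applied to the family of all [l]-subsets, [split] counts every permutation of [Y]. *)
rewrite -cards_draws -split; last by move=> A; rewrite inE.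
apply: eq_card => p; rewrite !inE andbC; case: (boolP (perm_on Y p)) => pY; rewrite ?andbF //.
rewrite -(im_perm_on pY) imsetS // card_imset ?Bl ?eqxx //; exact: perm_inj.
Qed.

Lemma exists_disjoint_blocks t l : t * l <= #|Y| ->
  exists2 B : nat -> {set T}, forall j, j < t -> (B j \subset Y) && (#|B j| == l) &
    forall i j, i < t -> j < t -> i != j -> [disjoint B i & B j].
Proof.
elim: t => [|t IH] tY; first by exists (fun=> set0).
have [|B Bl BD] := IH; first by apply: leq_trans tY; rewrite mulSn leq_addl.
pose U := \bigcup_(i < t) B i.
have cU : #|U| <= t * l.
  by apply: card_bigcup_ord => i /Bl/andP[_ /eqP->].
have : 0 < #|[set A : {set T} | A \subset Y :\: U & #|A| == l]|.
  rewrite cards_draws bin_gt0 cardsD.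
  have := subset_leq_card (subsetIr Y U); move: tY; rewrite mulSn; lia.
case/card_gt0P=> A; rewrite inE => /andP[]; rewrite subsetD => /andP[AY AU] Al.
have AB i : i < t -> [disjoint A & B i].
  by move=> lt; apply: disjointWr AU; apply: (bigcup_sup (Ordinal lt)).
exists (fun j => if j == t then A else B j) => [j|i j]; rewrite !ltnS.
  by case: eqVneq => [_|ne jt]; [rewrite AY|apply: Bl; rewrite ltn_neqAle ne].
move=> it jt ij; case: (eqVneq i t) => [ei|ni]; case: (eqVneq j t) => [ej|nj] //.
- by rewrite ei ej eqxx in ij.
- by apply: AB; rewrite ltn_neqAle nj.
- by rewrite disjoint_sym; apply: AB; rewrite ltn_neqAle ni.
- by apply: BD; rewrite // ltn_neqAle ?ni ?nj.
Qed.

End Averaging.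

(** * Distinct representatives and the weighted incidence bound *)

(** Choose greedily from the last index down: at index [i] only [m - i.+1] points are taken. *)
Lemma exists_sdr (I : finType) m (N : nat -> {set I}) :
  (forall i, i < m -> m - i <= #|N i|) ->
  exists r : seq I, [/\ size r = m, uniq r & forall i x0, i < m -> nth x0 r i \in N i].
Proof.
elim: m N => [|m IH] N Nm; first by exists [::].
have [|r [rs ru rN]] := IH (fun i => N i.+1); first by move=> i im; apply: (Nm i.+1).
have cr : #|[set z in r]| = m by rewrite cardsE (card_uniqP ru).
have : 0 < #|N 0 :\: [set z in r]|.
  rewrite cardsD; have := subset_leq_card (subsetIr (N 0) [set z in r]).
  rewrite cr; have := Nm 0 isT; lia.
case/card_gt0P=> x; rewrite !inE => /andP[xr xN].
exists (x :: r); split=> /=; [by rewrite rs|by rewrite xr|].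
by case=> [|i] x0 //= im; apply: rN.
Qed.

(** Since the greedy choice fails, some [N i] has at most [s - i] points, and by nestedness so has
    every later set. Earlier sets cost at most [#|I|] each; the rest costs at most
    [(s - i) * ((s - i) + s.+1)]. *)
Lemma nested_no_sdr_sum (I : finType) (s : nat) (N : nat -> {set I}) :
  (forall i j, i <= j -> j <= s -> N j \subset N i) ->
  ~ (exists r : seq I, [/\ size r = s.+1, uniq r & forall i x0, i < s.+1 -> nth x0 r i \in N i]) ->
  exists2 i, i <= s &
    \sum_(j < s) #|N j| + s.+1 * #|N s| <= i * #|I| + (s - i) * (2 * s).+1.
Proof.
move=> nest nosdr.
case: (boolP [exists i : 'I_s.+1, #|N i| <= s - i]) => [/existsP[[i lti] /= Ni]|]; last first.
  rewrite negb_exists => /forallP big; case: nosdr; apply: exists_sdr => i lti.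
  by have := big (Ordinal lti); rewrite /= -ltnNge subSn.
exists i => //; have small j : i <= j -> j <= s -> #|N j| <= s - i.
  by move=> ij js; apply: leq_trans Ni; apply/subset_leq_card/nest.
have s1 : \sum_(j < s) #|N j| <= i * #|I| + (s - i) * (s - i).
  rewrite -(big_mkord xpredT (fun j => #|N j|)) (big_cat_nat (n := i)) //=; apply: leq_add.
    rewrite -{2}(subn0 i) -sum_nat_const_nat; apply: leq_sum => j _; exact: max_card.
  rewrite -sum_nat_const_nat; rewrite big_nat_cond [leqRHS]big_nat_cond.
  apply: leq_sum => j /andP[/andP[ij js] _].
  exact: small (ltnW js).
have s2 : s.+1 * #|N s| <= s.+1 * (s - i) by rewrite leq_mul2l small.
apply: leq_trans (leq_add s1 s2) _.
by rewrite -addnA leq_add2l -mulnDl mulnC leq_mul2l; apply/orP; right; lia.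
Qed.

(** Linearity of expectation: each of the [t] randomly placed blocks lands in [H] with the same
    probability. *)
Lemma sum_perm_blocks (T : finType) (Y : {set T}) l t (B : nat -> {set T}) (H : {set {set T}}) :
  (forall j, j < t -> (B j \subset Y) && (#|B j| == l)) ->
  {in H, forall A : {set T}, (A \subset Y) && (#|A| == l)} ->
  'C(#|Y|, l) * (\sum_(p in perms_on Y) #|[set j : 'I_t | p @: B j \in H]|)
    = #|perms_on Y| * t * #|H|.
Proof.
move=> Bl Hl.
have -> : \sum_(p in perms_on Y) #|[set j : 'I_t | p @: B j \in H]|
    = \sum_(j < t) #|[set p in perms_on Y | p @: B j \in H]|.
  under eq_bigr do rewrite -sum1dep_card big_mkcond.
  rewrite exchange_big; apply: eq_bigr => j _.
  by rewrite -sum1dep_card -big_mkcondr.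
rewrite big_distrr /= (eq_bigr (fun=> #|H| * #|perms_on Y|)) => [|j _].
  by rewrite sum_nat_const card_ord; ring.
by have /andP[BY /eqP Bjl] := Bl j (ltn_ord j); apply: card_perms_into.
Qed.

(** The bound holds for the incidences with every placement of [t] disjoint blocks, hence for their
    average, which is proportional to the sum in question. *)
Lemma cross_dependent_sum (R : realFieldType) (T : finType) (Y : {set T}) l t s
    (H : nat -> {set {set T}}) (g : R) :
  t * l <= #|Y| ->
  (forall i, i <= s -> {in H i, forall A : {set T}, (A \subset Y) && (#|A| == l)}) ->
  (forall i j, i <= j -> j <= s -> H j \subset H i) ->
  ~ rainbow s.+1 H ->
  (1 <= g)%R -> ((2 * s).+1%:R <= g * t%:R)%R ->
  ((\sum_(i < s) #|H i| + s.+1 * #|H s|)%:R <= g * s%:R * 'C(#|Y|, l)%:R :> R)%R.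
Proof.
move=> tY Hl nest nor g1 gt.
have [B Bl BD] := exists_disjoint_blocks tY.
pose N (p : {perm T}) i := [set j : 'I_t | p @: B j \in H i].
pose S (h : nat -> nat) := \sum_(i < s) h i + s.+1 * h s.
(* The bound [i * t + (s - i) * (2 * s).+1] has [s] summands, each equal to [t] or [(2 * s).+1], and
   both are at most [g * t]. *)
have pw p : ((S (fun i => #|N p i|))%:R <= g * s%:R * t%:R :> R)%R.
  have [|r_sdr|i iS] := @nested_no_sdr_sum _ s (N p).
  - move=> i j ij js; apply/subsetP => z; rewrite !inE.
    exact: (subsetP (nest i j ij js)).
  (* Distinct representatives pick distinct, hence disjoint, blocks, whose images under [p] form a
     forbidden rainbow matching. *)
  - case: r_sdr => -[|x0 r] [//rs ru rN]; apply: nor.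
    exists (fun i => p @: B (nth x0 (x0 :: r) i)) => [i lti|i j lti ltj ij].
      by have := rN i x0 lti; rewrite inE.
    rewrite imset_disjoint; last exact: perm_inj.
    by apply: BD => //; rewrite (inj_eq val_inj) nth_uniq ?rs.
  rewrite card_ord -/(S _) -(ler_nat R) => /le_trans; apply.
  rewrite natrD !natrM natrB //.
  have iR : (i%:R <= s%:R :> R)%R by rewrite ler_nat.
  have i0 : (0 <= i%:R :> R)%R by apply: ler0n.
  have t0 : (0 <= t%:R :> R)%R by apply: ler0n.
  have e1 : (i%:R * t%:R <= g * (i%:R * t%:R) :> R)%R by rewrite ler_peMl ?mulr_ge0.
  have e2 : ((s%:R - i%:R) * (2 * s).+1%:R <= (s%:R - i%:R) * (g * t%:R) :> R)%R.
    by rewrite ler_wpM2l // subr_ge0.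
  apply: le_trans (lerD e1 e2) _; rewrite le_eqVlt; apply/orP; left; apply/eqP; ring.
have sum : 'C(#|Y|, l) * (\sum_(p in perms_on Y) S (fun i => #|N p i|))
    = #|perms_on Y| * t * S (fun i => #|H i|).
  rewrite /S big_split /= exchange_big /= -big_distrr /= mulnDr [RHS]mulnDr; congr (_ + _).
    rewrite !big_distrr /=; apply: eq_bigr => i _.
    by apply: sum_perm_blocks => //; apply: Hl; apply: ltnW.
  rewrite mulnCA sum_perm_blocks; [exact: mulnCA | by [] | exact: Hl].
have P0 : (0 < #|perms_on Y|%:R :> R)%R.
  by rewrite ltr0n; apply/card_gt0P; exists 1%g; rewrite inE perm_on1.
have t0 : (0 < t%:R :> R)%R.
  rewrite ltr0n lt0n; apply: contraTneq gt => ->.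
  by rewrite mulr0 -ltNge ltr0n.
have C0 : (0 <= 'C(#|Y|, l)%:R :> R)%R by apply: ler0n.
have le : ((\sum_(p in perms_on Y) S (fun i => #|N p i|))%:R
    <= #|perms_on Y|%:R * (g * s%:R * t%:R) :> R)%R.
  rewrite natr_sum mulr_natl -sumr_const; apply: ler_sum => p _; exact: pw.
rewrite -/(S (fun i => #|H i|)) -(ler_pM2l (mulr_gt0 P0 t0)) -!natrM -sum natrM.
apply: le_trans (ler_wpM2l C0 le) _; rewrite natrM le_eqVlt; apply/orP; left.
apply/eqP; ring.
Qed.

(** * Counting sets by their trace outside [Y] *)

(** Sort members by whether [#|A :\: Y|] is 0, 1 or larger; those with trace [[set x]] correspond to
    the sets inside [Y] in the link of [x]. *)
Lemma card_split_trace (T : finType) (Y : {set T}) (G : {set {set T}}) :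
  #|G| = #|[set A in G | A \subset Y]|
    + \sum_(x in ~: Y) #|[set B in link G x | B \subset Y]|
    + #|[set A in G | 1 < #|A :\: Y|]|.
Proof.
have link1 x : x \in ~: Y ->
    #|[set B in link G x | B \subset Y]| = \sum_(A in G) (A :\: Y == [set x]).
  rewrite inE => xY.
  rewrite -(card_in_imset (f := fun B => x |: B)); last first.
    move=> B C; rewrite !inE => /andP[/andP[xB _] _] /andP[/andP[xC _] _].
    by move/(congr1 (fun A => A :\ x)); rewrite !setU1K.
  rewrite -sum1_card big_mkcond [RHS]big_mkcond; apply: eq_bigr => A _.
  case: (boolP (A \in G)) => AG; last first.
    case: ifP => // /imsetP[B]; rewrite !inE => /andP[/andP[_ BG] _] e.
    by rewrite e BG in AG.
  case: eqVneq => e.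
    suff -> : A \in [set x |: B | B in [set B in link G x | B \subset Y]] by [].
    have /setDP[xA _] : x \in A :\: Y by rewrite e set11.
    apply/imsetP; exists (A :\ x); last by rewrite setD1K.
    by rewrite !inE eqxx setD1K // AG subDset setUC -subDset e /=.
  case: ifP => // /imsetP[B]; rewrite !inE => /andP[_ BY] eA; case/eqP: e.
  apply/setP => z; rewrite eA !inE; case: eqVneq => [->|_] /=; first by rewrite xY.
  by case: (boolP (z \in B)) => [/(subsetP BY)->|_]; rewrite ?andbF.
have cardG (P : pred {set T}) : #|[set A in G | P A]| = \sum_(A in G) P A.
  by rewrite -sum1dep_card big_mkcondr.
rewrite (eq_bigr _ link1) exchange_big /= !cardG -!big_split /= -sum1_card.
apply: eq_bigr => A _; rewrite -setD_eq0 -cards_eq0.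
have nul : ~~ (#|A :\: Y| == 1) -> \sum_(x in ~: Y) (A :\: Y == [set x]) = 0.
  by move=> n1; apply: big1 => x _; case: eqP => // e; rewrite e cards1 in n1.
case c: #|A :\: Y| nul => [|[|m]] nul; [by rewrite nul| |by rewrite nul].
rewrite /= addn0 add0n.
have /eqP/cards1P[x e] := c; rewrite e.
have xY : x \in ~: Y by have := set11 x; rewrite -e !inE => /andP[].
rewrite (bigD1 x) //= eqxx big1 // => z /andP[_ zx].
by rewrite (inj_eq set1_inj) eq_sym (negbTE zx).
Qed.

(** The same split for the complete uniform family expresses the number of sets with at least two
    points outside [Y] through binomials. *)
Lemma card_uniform_trace (T : finType) (Y : {set T}) k :
  'C(#|T|, k.+1) = 'C(#|Y|, k.+1) + #|~: Y| * 'C(#|Y|, k)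
    + #|[set A : {set T} | (#|A| == k.+1) && (1 < #|A :\: Y|)]|.
Proof.
rewrite -card_draws (card_split_trace Y); congr (_ + _ + _).
- by rewrite -cards_draws; apply: eq_card => A; rewrite !inE andbC.
- rewrite -sum_nat_const; apply: eq_bigr => x; rewrite inE => xY.
  rewrite -cards_draws; apply: eq_card => B; rewrite !inE [RHS]andbC.
  case: (boolP (B \subset Y)) => BY; rewrite ?andbF // !andbT.
  have xB : x \notin B by apply: contra xY; apply: subsetP.
  by rewrite cardsU1 xB eqSS.
- by apply: eq_card => A; rewrite !inE.
Qed.

Lemma sum_ord_lt n m (f : nat -> nat) : m <= n ->
  \sum_(x < n | x < m) f x = \sum_(i < m) f i.
Proof. by move=> mn; rewrite (big_ord_widen n f mn). Qed.

(** * The bound for shifted families *)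

Lemma shifted_bound (R : realFieldType) n k s t (g : R) (F : {set {set 'I_n}}) :
  shifted_on setT F -> {in F, forall A : {set 'I_n}, #|A| = k.+1} ->
  ~ rainbow s.+1 (fun=> F) -> s < n -> t * k <= n - s.+1 ->
  (1 <= g)%R -> ((2 * s).+1%:R <= g * t%:R)%R ->
  (#|F|%:R <= 'C(n, k.+1)%:R - 'C(n - s, k.+1)%:R + (g - 1) * s%:R * 'C(n - s.+1, k)%:R :> R)%R.
Proof.
move=> shT Fk nor sn tk g1 gt.
have sh (B : {set 'I_n}) (x y : 'I_n) : x < y -> x \notin B -> y \notin B -> y |: B \in F -> x |: B \in F.
  by apply: shT; rewrite in_setT.
(* Points of ['I_n] start at 0, so the first [s.+1] points are [0, ..., s], and [H s] below is the
   last link. *)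
pose Y := [set x : 'I_n | s < x].
have cX : #|~: Y| = s.+1.
  rewrite -sum1_card (eq_bigl (fun x : 'I_n => x < s.+1)) => [|x]; last by rewrite !inE -leqNgt.
  by rewrite (sum_ord_lt (fun=> 1) sn) sum_nat_const card_ord muln1.
have cY : #|Y| = n - s.+1 by have := cardsC Y; rewrite cX card_ord; lia.
pose H (i : nat) := [set B : {set 'I_n} | (B \subset Y) && [exists x : 'I_n, (x == i :> nat) && (B \in link F x)]].
have HE (x : 'I_n) : H x = [set B in link F x | B \subset Y].
  apply/setP => B; rewrite [in RHS]inE inE andbC; congr (_ && _).
  apply/existsP/idP => [[y /andP[/eqP yx]]|BF]; last by exists x; rewrite eqxx.
  by rewrite (val_inj yx).
have HP i B : B \in H i -> exists2 x : 'I_n, x = i :> nat & [/\ B \subset Y, x \notin B & x |: B \in F].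
  rewrite inE => /andP[BY /existsP[x /andP[/eqP xi]]]; rewrite inE => /andP[xB xF].
  by exists x.
have notY (x : 'I_n) (B : {set 'I_n}) : B \subset Y -> x <= s -> x \notin B.
  by move=> BY xs; apply: contraL xs => /(subsetP BY); rewrite inE -ltnNge.
pose F0 := [set A in F | A \subset Y].
have F0_bound : #|F0| <= s * #|H s|.
  apply: leq_trans (_ : s * #|shadow F0| <= _).
    apply: (@shadow_bound _ Y _ k.+1).
    - move=> B x y xY yY xy xB yB; rewrite [in X in X -> _]inE inE => /andP[yF yBY].
      rewrite (sh B x y) //; move: yBY; rewrite !subUset !sub1set => /andP[_ ->]; by rewrite xY.
    - by move=> A; rewrite inE => /andP[/Fk-> ->]; rewrite eqxx.
    - by case=> f fF fD; apply: nor; exists f => // i /fF; rewrite inE => /andP[].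
  rewrite leq_mul2l; apply/orP; right; apply/subset_leq_card/subsetP => B.
  rewrite inE => /existsP[x]; rewrite !inE subUset sub1set => /and3P[xB xF /andP[xY BY]].
  (* The removed point [x] lies in [Y], beyond [s], so it can be shifted to [s]; thus [B] is in the
     link of [s]. *)
  rewrite BY; apply/existsP; exists (Ordinal sn); rewrite eqxx inE /=.
  have sB : Ordinal sn \notin B by apply: notY.
  rewrite sB; apply: (sh B (Ordinal sn) x) => //.
  by rewrite inE in xY.
have sumH : \sum_(x in ~: Y) #|[set B in link F x | B \subset Y]| = \sum_(i < s.+1) #|H i|.
  rewrite -(sum_ord_lt (fun i => #|H i|) sn); apply: eq_big => x; first by rewrite !inE -leqNgt.
  by rewrite HE.
have key : ((\sum_(i < s) #|H i| + s.+1 * #|H s|)%:R <= g * s%:R * 'C(n - s.+1, k)%:R :> R)%R.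
  rewrite -cY in tk *; apply: (cross_dependent_sum tk) g1 gt => //.
  - move=> i _ B /HP[x _ [BY xB /Fk]]; rewrite cardsU1 xB add1n => -[->].
    by rewrite BY eqxx.
  - move=> i j; rewrite leq_eqVlt => /orP[/eqP->//|ij] js; apply/subsetP => B /HP[x xj [BY xB xF]].
    have iN : i < n by lia.
    rewrite inE BY; apply/existsP; exists (Ordinal iN); rewrite eqxx inE /=.
    have iB : Ordinal iN \notin B by apply: notY => //=; lia.
    by rewrite iB; apply: (sh B _ x) => //=; rewrite xj.
  (* Adding the distinct points [0, ..., s] outside [Y] turns a rainbow matching of the links into
     one of [F]. The default of [insubd] is never reached for [i < s.+1]. *)
  - case=> f fH fD; apply: nor.
    have xP i : i < s.+1 -> i < n by move=> lt; apply: leq_trans sn.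
    pose x (i : nat) : 'I_n := insubd (Ordinal sn) i.
    have xE i : i < s.+1 -> x i = i :> nat by move=> lt; rewrite val_insubd xP.
    have xf i j : i < s.+1 -> j < s.+1 -> x i \notin f j.
      by move=> lti ltj; apply: notY; [have [] := HP _ _ (fH j ltj) => ? _ []|rewrite xE].
    exists (fun i => x i |: f i) => [i lt|i j lti ltj ij].
      have [y yi [_ _ yF]] := HP _ _ (fH i lt).
      by rewrite (_ : x i = y) //; apply: val_inj; rewrite /= yi xE.
    have fij := fD i j lti ltj ij.
    rewrite disjoint_subset; apply/subsetP => z; rewrite !inE => /orP[/eqP ->|zi].
      by rewrite negb_or xf // andbT -(inj_eq val_inj) /= !xE.
    rewrite negb_or (disjointFr fij zi) andbT.
    by apply: contraNneq (xf j i ltj lti) => <-.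
have total := card_uniform_trace Y k; rewrite card_ord cX cY in total.
(* With [total] this makes ['C(n, k.+1) - 'C(n - s, k.+1)] equal to [s * 'C(n - s.+1, k)] plus the
   number of sets with two or more points outside [Y]; hence [g - 1] in the claim against [g] in
   [key]. *)
have pascal : 'C(n - s, k.+1) = 'C(n - s.+1, k.+1) + 'C(n - s.+1, k).
  by rewrite -binS; congr 'C(_, _); lia.
have big : #|[set A in F | 1 < #|A :\: Y|]|
    <= #|[set A : {set 'I_n} | (#|A| == k.+1) && (1 < #|A :\: Y|)]|.
  by apply/subset_leq_card/subsetP => A; rewrite !inE => /andP[/Fk-> ->]; rewrite eqxx.
have FE := card_split_trace Y F; rewrite sumH big_ord_recr /= in FE.
move: key; set S := (\sum_(i < s) _ + _)%N => key.
set D := #|[set A : {set 'I_n} | _ && _]| in big total.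
(* By [F0_bound] the members inside [Y] cost [s] more copies of [#|H s|], which raises its weight to
   [s.+1]. *)
have le : #|F| <= S + D.
  by rewrite /S FE mulSn leq_add // addnC -addnA !leq_add2l.
rewrite -(ler_nat R) natrD in le; apply: le_trans le _.
have natrS C : ((s.+1 * C)%:R = (s%:R + 1) * C%:R :> R)%R by rewrite natrM -natr1.
rewrite total pascal (natrD _ _ D) (natrD _ _ (s.+1 * _)) natrS natrD.
rewrite -subr_ge0 in key; rewrite -subr_ge0.
apply: le_trans key _; rewrite le_eqVlt; apply/orP; left; apply/eqP; ring.
Qed.

(** * Choice of parameters *)

Local Open Scope ring_scope.

Theorem theorem1p8 (R : realType) (n k s : nat) (alpha : R)
  (hk : (0 < k)%N)
  (halpha1 : 1 < alpha) (halpha2 : alpha <= 2 - 1 / k%:R)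
  (hn : alpha * k%:R * (s.+1)%:R + k%:R - 1 <= n%:R)
  (F : {set {set 'I_n}})
  (hF : forall A, A \in F -> #|A| = k)
  (hnu : nu F = s) :
  (#|F|%:R : R) <=
    'C(n, k)%:R - 'C(n - s, k)%:R
    + ((2 - alpha) * k%:R - 1) / (alpha * k%:R - 1) * s%:R * 'C(n - s - 1, k - 1)%:R.
Proof.
(* From here on [k] is one less than the size of the members. *)
case: k hk halpha2 hn hF => // k _ halpha2 hn hF.
have ak2 : alpha * k.+1%:R <= 2 * k%:R + 1.
  have := halpha2; rewrite -(ler_pM2r (ltr0Sn R k)) mulrBl div1r mulVf ?pnatr_eq0 //.
  by rewrite -natr1; lra.
have ak1 : k%:R + 1 < alpha * k.+1%:R by rewrite natr1 ltr_pMl.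
have k0 : 0 <= k%:R :> R by apply: ler0n.
have s1 : 1 <= s.+1%:R :> R by rewrite ler1n.
(* The range of [alpha] gives [k + 1 < 2 * k + 1], so the division by [k] in [t] is meaningful. *)
have kpos : (0 < k)%N by rewrite -(ltr0n R); lra.
have d0 : 0 < alpha * k.+1%:R - 1 by lra.
have m1 : (alpha * k.+1%:R - 1) * s.+1%:R + k%:R <= n%:R - s.+1%:R.
  by move: hn; rewrite -[in X in _ + X - _]natr1; lra.
have sn : (s < n)%N.
  by rewrite -(ler_nat R) -subr_ge0; apply: le_trans m1; rewrite addr_ge0 // mulr_ge0 // ltW.
pose t := ((n - s.+1) %/ k)%N.
(* Rounding down loses less than [k], which the summand [k] in [m1] absorbs. *)
have tk : (alpha * k.+1%:R - 1) * s.+1%:R <= t%:R * k%:R.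
  have : (n - s.+1 < t * k + k)%N by rewrite addnC -mulSn; apply: ltn_ceil.
  by rewrite -(ltr_nat R) natrB // natrD natrM; lra.
pose g : R := 2 * k%:R / (alpha * k.+1%:R - 1).
have g1 : 1 <= g by rewrite ler_pdivlMr //; lra.
(* By [tk], [g * t] is even at least [2 * s.+1]. *)
have gt : (2 * s).+1%:R <= g * t%:R.
  rewrite /g mulrAC ler_pdivlMr //.
  have -> : (2 * s).+1%:R = 2 * s.+1%:R - 1 :> R by rewrite -!natr1 natrM; ring.
  lra.
have [F' [<- F'k F'm F'sh]] : exists F' : {set {set 'I_n}}, [/\ #|F'| = #|F|,
    {in F', forall A : {set 'I_n}, #|A| = k.+1}, ~ rainbow s.+1 (fun=> F') & shifted_on setT F'].
  apply: exists_shifted => // /nu_rainbow; rewrite hnu ltnn => nuF.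
  by suff /nuF : set0 \notin F by []; apply/negP => /hF; rewrite cards0.
have := shifted_bound F'sh F'k F'm sn (leq_divM _ _) g1 gt.
rewrite -subnDA addn1 subn1 /=.
suff -> : g - 1 = ((2 - alpha) * k.+1%:R - 1) / (alpha * k.+1%:R - 1) by [].
apply: (mulIf (lt0r_neq0 d0)); rewrite mulrBl !divfK ?lt0r_neq0 // -natr1; ring.
Qed.
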